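(* Let $m\ge 1$ be an integer and let $\{\beta_{2\lambda}\}_{\lambda=-2m+1}^{2m}$ be the real mask of a $4m$-point binary subdivision scheme. Let $f=(f_i)_{i\in\mathbb{Z}}$ be a real sequence and let $h=(h_i)_{i\in\mathbb{Z}}$ be the sequence obtained by applying the $4m$-point binary scheme twice to $f$. Then for all $\varphi\in\mathbb{Z}$ $$h_{4\varphi-2}=\sum_{\lambda=-m+1}^{m}\sum_{\alpha=-2m}^{2m-1}\beta_{4-4\lambda}\beta_{-2\alpha}\,f_{\varphi+\alpha+\lambda}+\sum_{\lambda=-m+1}^{m}\sum_{\alpha=-2m}^{2m-1}\beta_{2-4\lambda}\beta_{2+2\alpha}\,f_{\varphi+\alpha+\lambda},$$ $$h_{4\varphi-1}=\sum_{\lambda=-m+1}^{m}\sum_{\alpha=-2m}^{2m-1}\beta_{4\lambda-2}\beta_{-2\alpha}\,f_{\varphi+\alpha+\lambda}+\sum_{\lambda=-m+1}^{m}\sum_{\alpha=-2m}^{2m-1}\beta_{4\lambda}\beta_{2+2\alpha}\,f_{\varphi+\alpha+\lambda},$$ $$h_{4\varphi}=\sum_{\lambda=-m+1}^{m}\sum_{\alpha=-2m}^{2m-1}\beta_{4-4\lambda}\beta_{2+2\alpha}\,f_{\varphi+\alpha+\lambda}+\sum_{\lambda=-m+1}^{m}\sum_{\alpha=-2m}^{2m-1}\beta_{2-4\lambda}\beta_{-2\alpha}\,f_{\varphi+\alpha+\lambda+1},$$ $$h_{4\varphi+1}=\sum_{\lambda=-m+1}^{m}\sum_{\alpha=-2m}^{2m-1}\beta_{4\lambda-2}\beta_{2+2\alpha}\,f_{\varphi+\alpha+\lambda}+\sum_{\lambda=-m+1}^{m}\sum_{\alpha=-2m}^{2m-1}\beta_{4\lambda}\beta_{-2\alpha}\,f_{\varphi+\alpha+\lambda+1}.$$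 Consequently these four equations, read as a map $f=g^{k}\mapsto h=g^{k+1}$, are the four subdivision rules of a $(6m-1)$-point relaxed quaternary subdivision scheme, whose coefficients of the control points are non-linear combinations (sums of products of two mask elements) of the coefficients of the $4m$-point binary subdivision scheme.
   Context: The $4m$-point binary subdivision scheme with mask $\{\beta_{2\lambda}\}_{\lambda=-2m+1}^{2m}$ maps a sequence $(g_i)_{i\in\mathbb{Z}}$ to the sequence $(G_i)_{i\in\mathbb{Z}}$ given for all $\varphi\in\mathbb{Z}$ by $$G_{2\varphi-1}=\sum_{\lambda=-2m+1}^{2m}\beta_{2\lambda}\,g_{\varphi+\lambda-1},\qquad G_{2\varphi}=\sum_{\lambda=-2m+1}^{2m}\beta_{2-2\lambda}\,g_{\varphi+\lambda}.$$ A quaternary subdivision scheme is a linear map on sequences $(g^k_i)\mapsto(g^{k+1}_i)$ given by four rules, one for each of $g^{k+1}_{4\varphi-2},g^{k+1}_{4\varphi-1},g^{k+1}_{4\varphi},g^{k+1}_{4\varphi+1}$, each a finite linear combination of the $g^k_{\varphi+j}$ with coefficients independent of $\varphi$ and $k$. It is called here ''$(6m-1)$-point relaxed'' when the rules for $g^{k+1}_{4\varphi-2},g^{k+1}_{4\varphi-1}$ use the $6m-1$ control points $g^k_{\varphi-3m+1},\dots,g^k_{\varphi+3m-1}$ and the rules for $g^{k+1}_{4\varphi},g^{k+1}_{4\varphi+1}$ use the $6m$ control points $g^k_{\varphi-3m+1},\dots,g^k_{\varphi+3m}$. *)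

(* Defs.v *)
From HB Require Import structures.
From mathcomp Require Import all_boot all_order all_algebra.
From mathcomp Require Import zify.
From mathcomp Require Import classical_sets functions reals.
Set Implicit Arguments.
Unset Strict Implicit.
Unset Printing Implicit Defensive.
Import Order.TTheory GRing.Theory Num.Theory.
Local Open Scope ring_scope.

(* Integers a, a + 1, ..., b (none if b < a); the sum of F l over l = a, ..., b
   is \sum_(l <- zrange a b) F l. *)
Definition zrange (a b : int) : seq int :=
  [seq a + k%:Z | k <- iota 0 (absz (Num.max 0 (b - a + 1)))].

Lemma mem_zrange (a b x : int) : (x \in zrange a b) = (a <= x <= b).
Proof.
apply/mapP/idP => [[k]|/andP[ax xb]]; first by rewrite mem_iota; lia.
exists (absz (x - a)); last lia.
by rewrite mem_iota; lia.
Qed.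

Lemma zrange_uniq (a b : int) : uniq (zrange a b).
Proof. by rewrite map_inj_uniq ?iota_uniq // => i j; lia. Qed.

Lemma size_zrange (a b : int) : a <= b + 1 -> size (zrange a b) = absz (b - a + 1).
Proof. by rewrite size_map size_iota; lia. Qed.

Section Schemes.
Variable R : realType.

(* The mask is a function on int of which only the values at the even integers
   2 l, - 2 m + 1 <= l <= 2 m, are ever used. *)
Definition mask_indices (m : nat) : seq int :=
  [seq 2 * l | l <- zrange (- 2 * m%:Z + 1) (2 * m%:Z)].

Definition binary_scheme (m : nat) (beta : int -> R) (g : int -> R) : int -> R :=
  fun i =>
    if (2 %| i)%Z then
      \sum_(l <- zrange (- 2 * m%:Z + 1) (2 * m%:Z))
        beta (2 - 2 * l) * g ((i %/ 2)%Z + l)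
    else
      \sum_(l <- zrange (- 2 * m%:Z + 1) (2 * m%:Z))
        beta (2 * l) * g (((i + 1) %/ 2)%Z + l - 1).

Lemma binary_scheme_odd m beta g (phi : int) :
  binary_scheme m beta g (2 * phi - 1) =
  \sum_(l <- zrange (- 2 * m%:Z + 1) (2 * m%:Z)) beta (2 * l) * g (phi + l - 1).
Proof.
rewrite /binary_scheme ifF; last lia.
by have -> : ((2 * phi - 1 + 1) %/ 2)%Z = phi by lia.
Qed.

Lemma binary_scheme_even m beta g (phi : int) :
  binary_scheme m beta g (2 * phi) =
  \sum_(l <- zrange (- 2 * m%:Z + 1) (2 * m%:Z)) beta (2 - 2 * l) * g (phi + l).
Proof.
rewrite /binary_scheme ifT; last lia.
by have -> : ((2 * phi) %/ 2)%Z = phi by lia.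
Qed.

Definition quaternary_equations (m : nat) (beta f h : int -> R) : Prop :=
  forall phi : int,
  [/\ h (4 * phi - 2) =
        \sum_(l <- zrange (- m%:Z + 1) m%:Z)
          \sum_(a <- zrange (- 2 * m%:Z) (2 * m%:Z - 1))
            beta (4 - 4 * l) * beta (- 2 * a) * f (phi + a + l)
      + \sum_(l <- zrange (- m%:Z + 1) m%:Z)
          \sum_(a <- zrange (- 2 * m%:Z) (2 * m%:Z - 1))
            beta (2 - 4 * l) * beta (2 + 2 * a) * f (phi + a + l),
      h (4 * phi - 1) =
        \sum_(l <- zrange (- m%:Z + 1) m%:Z)
          \sum_(a <- zrange (- 2 * m%:Z) (2 * m%:Z - 1))
            beta (4 * l - 2) * beta (- 2 * a) * f (phi + a + l)
      + \sum_(l <- zrange (- m%:Z + 1) m%:Z)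
          \sum_(a <- zrange (- 2 * m%:Z) (2 * m%:Z - 1))
            beta (4 * l) * beta (2 + 2 * a) * f (phi + a + l),
      h (4 * phi) =
        \sum_(l <- zrange (- m%:Z + 1) m%:Z)
          \sum_(a <- zrange (- 2 * m%:Z) (2 * m%:Z - 1))
            beta (4 - 4 * l) * beta (2 + 2 * a) * f (phi + a + l)
      + \sum_(l <- zrange (- m%:Z + 1) m%:Z)
          \sum_(a <- zrange (- 2 * m%:Z) (2 * m%:Z - 1))
            beta (2 - 4 * l) * beta (- 2 * a) * f (phi + a + l + 1)
    & h (4 * phi + 1) =
        \sum_(l <- zrange (- m%:Z + 1) m%:Z)
          \sum_(a <- zrange (- 2 * m%:Z) (2 * m%:Z - 1))
            beta (4 * l - 2) * beta (2 + 2 * a) * f (phi + a + l)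
      + \sum_(l <- zrange (- m%:Z + 1) m%:Z)
          \sum_(a <- zrange (- 2 * m%:Z) (2 * m%:Z - 1))
            beta (4 * l) * beta (- 2 * a) * f (phi + a + l + 1)].

(* Rule r : 'I_4 computes the new value of index 4 phi - 2 + r from the old
   values of indices phi + j, j in pts r.  The coefficients c r j depend neither
   on phi nor on the refinement level, S being the map used at every level. *)
Definition quaternary_scheme (pts : 'I_4 -> seq int) (c : 'I_4 -> int -> R)
    (S : (int -> R^o) -> (int -> R^o)) : Prop :=
  linear S /\
  forall (r : 'I_4) (g : int -> R) (phi : int),
    S g (4 * phi - 2 + r%:Z) = \sum_(j <- pts r) c r j * g (phi + j).

Definition relaxed_points (m : nat) (r : 'I_4) : seq int :=
  if (r < 2)%N then zrange (- 3 * m%:Z + 1) (3 * m%:Z - 1)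
  else zrange (- 3 * m%:Z + 1) (3 * m%:Z).

Definition relaxed_quaternary_scheme (m : nat) :=
  quaternary_scheme (relaxed_points m).

Lemma size_relaxed_points m r : (1 <= m)%N ->
  size (relaxed_points m r) = if (r < 2)%N then (6 * m - 1)%N else (6 * m)%N.
Proof. by rewrite /relaxed_points; case: ifP => _ m1; rewrite size_zrange; lia. Qed.

(* The list s of index pairs is chosen before beta, so c is a fixed quadratic
   form in the mask; as s is nonempty, c is nonzero, hence non-linear. *)
Definition sum_of_mask_products (m : nat) (c : (int -> R) -> R) : Prop :=
  exists s : seq (int * int),
    [/\ s != [::],
        all (fun p => (p.1 \in mask_indices m) && (p.2 \in mask_indices m)) s
      & forall beta : int -> R, c beta = \sum_(p <- s) beta p.1 * beta p.2].

End Schemes.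

(* Main.v *)
Require Import Defs.
From mathcomp Require Import all_boot all_order all_algebra.
From mathcomp Require Import classical_sets functions reals.
From mathcomp Require Import boolp zify.
Import Order.TTheory GRing.Theory Num.Theory.
Local Open Scope ring_scope.

(** The four equations come from splitting the sum of the outer binary step by
the parity of its summation index ([binary_scheme_even_split],
[binary_scheme_odd_split]): each half evaluates the inner step at indices of a
single parity, so that one binary rule applies throughout, and translating its
summation index by one ([binary_scheme_even_shift], [binary_scheme_odd_shift])
gives the stated double sums.

For the second part, every one of the four equations has the shape
[h (4 * phi - 2 + r) = \sum_(t <- T r) beta t.1.1 * beta t.1.2 * f (phi + t.2)]
for a finite list [T r] ([rule_terms]) of pairs of mask indices tagged by an
offset, independent of the mask.  Grouping the terms by offset
([sum_by_offset]) makes the coefficient of the control point [phi + j] the sum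
of [beta p.1 * beta p.2] over the pairs [p] with tag [j].  What remains is
arithmetic on the index ranges: all offsets lie among the relaxed points, and
each relaxed point is attained ([rule_pairs_nonempty]).  Linearity of the map
follows from the rules, as every integer is [4 * phi - 2 + r] for some [phi]
and some [r < 4]. *)

(** * Sums over integer intervals *)

Lemma big_zrange_shift (V : nmodType) (a b : int) (F : int -> V) :
  \sum_(l <- zrange a b) F l = \sum_(l <- zrange (a - 1) (b - 1)) F (l + 1).
Proof.
rewrite -(big_map (fun l => l + 1) xpredT F); apply: perm_big; apply: uniq_perm.
- exact: zrange_uniq.
- by rewrite map_inj_uniq ?zrange_uniq // => x y; lia.
move=> x; rewrite mem_zrange; apply/idP/mapP => [xab|[y]].
  by exists (x - 1); rewrite ?mem_zrange; lia.
by rewrite mem_zrange; lia.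
Qed.

Lemma big_zrange_parity (V : nmodType) (m : nat) (F : int -> V) :
  \sum_(l <- zrange (- 2 * m%:Z + 1) (2 * m%:Z)) F l =
  \sum_(l <- zrange (- m%:Z + 1) m%:Z) F (2 * l - 1) +
  \sum_(l <- zrange (- m%:Z + 1) m%:Z) F (2 * l).
Proof.
rewrite -(big_map (fun l => 2 * l - 1) xpredT F).
rewrite -(big_map (fun l => 2 * l) xpredT F) -big_cat.
apply: perm_big; apply: uniq_perm; first exact: zrange_uniq.
  rewrite cat_uniq !map_inj_uniq ?iota_uniq; try by move=> x y; lia.
  rewrite /= andbT; apply/hasPn => _ /mapP[x _ ->].
  by apply/mapP => -[y _]; lia.
move=> x; rewrite mem_zrange mem_cat; apply/idP/orP => [xm|[]/mapP[y]]; last first.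
- by rewrite mem_zrange; lia.
- by rewrite mem_zrange; lia.
have [xe|xo] := boolP (2 %| x)%Z; [right|left]; apply/mapP.
  by exists (x %/ 2)%Z; rewrite ?mem_zrange; lia.
by exists ((x + 1) %/ 2)%Z; rewrite ?mem_zrange; lia.
Qed.

Lemma sum_by_offset {R : pzSemiRingType} {T : Type} (s : seq (T * int))
    (pts : seq int) (w : T -> R) (g : int -> R) :
    uniq pts -> all (fun t => t.2 \in pts) s ->
  \sum_(t <- s) w t.1 * g t.2 =
  \sum_(j <- pts) (\sum_(t <- s | t.2 == j) w t.1) * g j.
Proof.
move=> upts; under [RHS]eq_bigr do rewrite mulr_suml big_mkcond /=.
rewrite exchange_big /=; elim: s => [|t s IHs] /=; first by rewrite !big_nil.
move=> /andP[tpts /IHs IH]; rewrite !big_cons IH; congr (_ + _).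
rewrite (bigD1_seq t.2) //= eqxx big1 ?addr0 // => j.
by rewrite eq_sym => /negPf ->.
Qed.

(** * Two binary steps *)

Section TwoBinarySteps.
Context {R : realType}.
Variables (m : nat) (beta g : int -> R).

Lemma binary_scheme_odd_shift (phi : int) :
  binary_scheme m beta g (2 * phi - 1) =
  \sum_(a <- zrange (- 2 * m%:Z) (2 * m%:Z - 1)) beta (2 + 2 * a) * g (phi + a).
Proof.
rewrite binary_scheme_odd big_zrange_shift addrK.
by apply: eq_bigr => a _; congr (beta _ * g _); lia.
Qed.

Lemma binary_scheme_even_shift (phi : int) :
  binary_scheme m beta g (2 * phi) =
  \sum_(a <- zrange (- 2 * m%:Z) (2 * m%:Z - 1))
    beta (- 2 * a) * g (phi + a + 1).
Proof.
rewrite binary_scheme_even big_zrange_shift addrK.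
by apply: eq_bigr => a _; congr (beta _ * g _); lia.
Qed.

Lemma binary_scheme_odd_split (phi : int) :
  binary_scheme m beta g (2 * phi - 1) =
  \sum_(l <- zrange (- m%:Z + 1) m%:Z) beta (4 * l - 2) * g (phi + 2 * l - 2) +
  \sum_(l <- zrange (- m%:Z + 1) m%:Z) beta (4 * l) * g (phi + 2 * l - 1).
Proof.
rewrite binary_scheme_odd big_zrange_parity.
by congr (_ + _); apply: eq_bigr => l _; congr (beta _ * g _); lia.
Qed.

Lemma binary_scheme_even_split (phi : int) :
  binary_scheme m beta g (2 * phi) =
  \sum_(l <- zrange (- m%:Z + 1) m%:Z) beta (4 - 4 * l) * g (phi + 2 * l - 1) +
  \sum_(l <- zrange (- m%:Z + 1) m%:Z) beta (2 - 4 * l) * g (phi + 2 * l).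
Proof.
rewrite binary_scheme_even big_zrange_parity.
by congr (_ + _); apply: eq_bigr => l _; congr (beta _ * g _); lia.
Qed.

End TwoBinarySteps.

Lemma binary_scheme_twice (R : realType) (m : nat) (beta f : int -> R) :
  quaternary_equations m beta f
    (binary_scheme m beta (binary_scheme m beta f)).
Proof.
(* Reduces each half of the outer sum to one rule E of the inner step, taken at
   the point p l. *)
have step (c : int -> int) (i p : int -> int) (v : int -> int) d
    (E : forall phi, binary_scheme m beta f (i phi) =
       \sum_(a <- zrange (- 2 * m%:Z) (2 * m%:Z - 1))
          beta (v a) * f (phi + a + d)) (n : int -> int) (F : int -> int -> int) :
    (forall l, n l = i (p l)) -> (forall l a, F l a = p l + a + d) ->
  \sum_(l <- zrange (- m%:Z + 1) m%:Z)
     beta (c l) * binary_scheme m beta f (n l) =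
  \sum_(l <- zrange (- m%:Z + 1) m%:Z)
    \sum_(a <- zrange (- 2 * m%:Z) (2 * m%:Z - 1))
      beta (c l) * beta (v a) * f (F l a).
  move=> nE FE; apply: eq_bigr => l _; rewrite nE E mulr_sumr.
  by apply: eq_bigr => a _; rewrite mulrA FE.
have odd0 phi : binary_scheme m beta f (2 * phi - 1) =
    \sum_(a <- zrange (- 2 * m%:Z) (2 * m%:Z - 1))
      beta (2 + 2 * a) * f (phi + a + 0).
  by rewrite binary_scheme_odd_shift; apply: eq_bigr => a _; rewrite addr0.
have even1 := binary_scheme_even_shift m beta f.
move=> phi; split.
- have -> : 4 * phi - 2 = 2 * (2 * phi - 1) by lia.
  rewrite binary_scheme_even_split; congr (_ + _).
    by apply: (step _ _ (fun l => phi + l - 1) _ _ even1) => *; lia.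
  by apply: (step _ _ (fun l => phi + l) _ _ odd0) => *; lia.
- have -> : 4 * phi - 1 = 2 * (2 * phi) - 1 by lia.
  rewrite binary_scheme_odd_split; congr (_ + _).
    by apply: (step _ _ (fun l => phi + l - 1) _ _ even1) => *; lia.
  by apply: (step _ _ (fun l => phi + l) _ _ odd0) => *; lia.
- have -> : 4 * phi = 2 * (2 * phi) by lia.
  rewrite binary_scheme_even_split; congr (_ + _).
    by apply: (step _ _ (fun l => phi + l) _ _ odd0) => *; lia.
  by apply: (step _ _ (fun l => phi + l) _ _ even1) => *; lia.
- have -> : 4 * phi + 1 = 2 * (2 * phi + 1) - 1 by lia.
  rewrite binary_scheme_odd_split; congr (_ + _).
    by apply: (step _ _ (fun l => phi + l) _ _ odd0) => *; lia.
  by apply: (step _ _ (fun l => phi + l) _ _ even1) => *; lia.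
Qed.

(** * The coefficients of the quaternary rules *)

(** The terms of one double sum of the equations: a pair of mask indices
[(u l, v a)] together with the offset [a + l + d] of the control point that
their product multiplies. *)
Definition product_terms (m : nat) (u v : int -> int) (d : int) :
    seq ((int * int) * int) :=
  [seq ((u l, v a), a + l + d) | l <- zrange (- m%:Z + 1) m%:Z,
                                 a <- zrange (- 2 * m%:Z) (2 * m%:Z - 1)].

(** All the terms of the equation for the new value of index
[4 * phi - 2 + r]. *)
Definition rule_terms (m : nat) (r : nat) : seq ((int * int) * int) :=
  match r with
  | 0%N => product_terms m (fun l => 4 - 4 * l) (fun a => - 2 * a) 0
      ++ product_terms m (fun l => 2 - 4 * l) (fun a => 2 + 2 * a) 0
  | 1%N => product_terms m (fun l => 4 * l - 2) (fun a => - 2 * a) 0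
      ++ product_terms m (fun l => 4 * l) (fun a => 2 + 2 * a) 0
  | 2%N => product_terms m (fun l => 4 - 4 * l) (fun a => 2 + 2 * a) 0
      ++ product_terms m (fun l => 2 - 4 * l) (fun a => - 2 * a) 1
  | _ => product_terms m (fun l => 4 * l - 2) (fun a => 2 + 2 * a) 0
      ++ product_terms m (fun l => 4 * l) (fun a => - 2 * a) 1
  end.

(** The pairs of mask indices whose products make up the coefficient of the
control point of offset [j] in rule [r]. *)
Definition rule_pairs (m r : nat) (j : int) : seq (int * int) :=
  [seq t.1 | t <- rule_terms m r & t.2 == j].

Definition rule_coef {R : realType} (m : nat) (beta : int -> R) (r : 'I_4)
    (j : int) : R :=
  \sum_(p <- rule_pairs m r j) beta p.1 * beta p.2.

Lemma sum_product_terms (R : realType) (m : nat) (beta f : int -> R)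
    (u v : int -> int) (d phi : int) :
  \sum_(t <- product_terms m u v d) beta t.1.1 * beta t.1.2 * f (phi + t.2) =
  \sum_(l <- zrange (- m%:Z + 1) m%:Z)
    \sum_(a <- zrange (- 2 * m%:Z) (2 * m%:Z - 1))
      beta (u l) * beta (v a) * f (phi + a + l + d).
Proof.
rewrite big_allpairs_dep; apply: eq_bigr => l _; apply: eq_bigr => a _ /=.
by rewrite !addrA.
Qed.

Lemma quaternary_equations_terms (R : realType) (m : nat)
    (beta f h : int -> R) :
    quaternary_equations m beta f h ->
  forall (r : 'I_4) (phi : int),
  h (4 * phi - 2 + r%:Z) =
  \sum_(t <- rule_terms m r) beta t.1.1 * beta t.1.2 * f (phi + t.2).
Proof.
move=> eqs r phi; have [h0 h1 h2 h3] := eqs phi.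
case: r => [[|[|[|[|k]]]] r4] /=; last discriminate r4;
  rewrite big_cat !sum_product_terms.
- rewrite addr0 h0.
  by congr (_ + _); do 2![apply: eq_bigr => ? _]; rewrite addr0.
- have -> : 4 * phi - 2 + 1 = 4 * phi - 1 by lia.
  by rewrite h1; congr (_ + _); do 2![apply: eq_bigr => ? _]; rewrite addr0.
- have -> : 4 * phi - 2 + 2 = 4 * phi by lia.
  by rewrite h2; congr (_ + _); do 2![apply: eq_bigr => ? _]; rewrite addr0.
- have -> : 4 * phi - 2 + 3 = 4 * phi + 1 by lia.
  by rewrite h3; congr (_ + _); do 2![apply: eq_bigr => ? _]; rewrite addr0.
Qed.

Lemma product_termsP {m : nat} {u v : int -> int} {d : int}
    {P : pred ((int * int) * int)} :
    (forall l a : int, - m%:Z + 1 <= l <= m%:Z ->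
       - 2 * m%:Z <= a <= 2 * m%:Z - 1 -> P ((u l, v a), a + l + d)) ->
  all P (product_terms m u v d).
Proof.
move=> PP; apply/allP => t /allpairsP[[l a] [/= lm am ->]].
by apply: PP; rewrite -mem_zrange.
Qed.

Lemma rule_terms_offset (m : nat) (r : 'I_4) :
  all (fun t => t.2 \in relaxed_points m r) (rule_terms m r).
Proof.
case: r => [[|[|[|[|k]]]] r4] /=; last discriminate r4.
all: rewrite all_cat; apply/andP; split;
  by apply: product_termsP => l a /andP[? ?] /andP[? ?];
    rewrite mem_zrange /=; apply/andP; split; lia.
Qed.

Lemma mem_mask_indices (m : nat) (x : int) :
  (x \in mask_indices m) = (2 %| x)%Z && (- 4 * m%:Z + 2 <= x <= 4 * m%:Z).
Proof.
apply/mapP/idP => [[l]|xm]; first by rewrite mem_zrange; lia.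
by exists (x %/ 2)%Z; rewrite ?mem_zrange; lia.
Qed.

Lemma rule_terms_mask_indices (m : nat) (r : 'I_4) :
  all (fun t => (t.1.1 \in mask_indices m) && (t.1.2 \in mask_indices m))
    (rule_terms m r).
Proof.
case: r => [[|[|[|[|k]]]] r4] /=; last discriminate r4.
all: rewrite all_cat; apply/andP; split;
  by apply: product_termsP => l a /andP[? ?] /andP[? ?];
    rewrite !mem_mask_indices /=; lia.
Qed.

Lemma product_terms_offset_attained (m : nat) (u v : int -> int) (d j : int) :
    (1 <= m)%N -> - 3 * m%:Z + 1 <= j - d <= 3 * m%:Z - 1 ->
  has (fun t => t.2 == j) (product_terms m u v d).
Proof.
move=> m1 jm.
(* The first index is j - d clamped to its range, the second one makes up the
   difference. *)
pose l : int := Num.max (- m%:Z + 1) (Num.min m%:Z (j - d)).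
apply/hasP; exists ((u l, v (j - d - l)), j - d - l + l + d) => /=; last lia.
by apply/allpairsP; exists (l, j - d - l); rewrite /= !mem_zrange /l; split=> //; lia.
Qed.

(** In the last two rules the first double sum misses only the rightmost
control point, which the second one, translated by one, reaches. *)
Lemma rule_pairs_nonempty (m : nat) (r : 'I_4) (j : int) :
  (1 <= m)%N -> j \in relaxed_points m r -> rule_pairs m r j != [::].
Proof.
move=> m1 jr; rewrite -size_eq0 size_map size_filter -lt0n -has_count.
case: r jr => [[|[|[|[|k]]]] r4]; last discriminate r4;
 
  rewrite /relaxed_points /= mem_zrange has_cat => jr; apply/orP.
- by left; apply: product_terms_offset_attained => //; lia.
- by left; apply: product_terms_offset_attained => //; lia.
- have [jm|jm] := eqVneq j (3 * m%:Z); [right|left];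
    by apply: product_terms_offset_attained => //; lia.
- have [jm|jm] := eqVneq j (3 * m%:Z); [right|left];
    by apply: product_terms_offset_attained => //; lia.
Qed.

Lemma rule_coef_mask_products (R : realType) (m : nat) (r : 'I_4) (j : int) :
    (1 <= m)%N -> j \in relaxed_points m r ->
  sum_of_mask_products m (fun beta : int -> R => rule_coef m beta r j).
Proof.
move=> m1 jr; exists (rule_pairs m r j); split=> //.
  exact: rule_pairs_nonempty.
rewrite all_map; apply/allP => t; rewrite mem_filter => /andP[_ tr].
exact: (allP (rule_terms_mask_indices m r)).
Qed.

(** A map given by four rules is linear, whatever the coefficients. *)
Lemma quaternary_rules_linear (R : realType) (pts : 'I_4 -> seq int)
    (c : 'I_4 -> int -> R) (S : (int -> R^o) -> (int -> R^o)) :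
    (forall (r : 'I_4) (g : int -> R) (phi : int),
       S g (4 * phi - 2 + r%:Z) = \sum_(j <- pts r) c r j * g (phi + j)) ->
  quaternary_scheme pts c S.
Proof.
move=> rules; split=> // x g h; apply/funext => n.
have r4 : (absz ((n + 2) %% 4)%Z < 4)%N by lia.
have -> : n = 4 * ((n + 2) %/ 4)%Z - 2 + (Ordinal r4)%:Z by rewrite /=; lia.
rewrite rules !fctE !rules scaler_sumr -big_split; apply: eq_bigr => j _ /=.
by rewrite mulrDr /GRing.scale /= mulrCA.
Qed.

Lemma quaternary_equations_scheme (R : realType) (m : nat) (beta : int -> R)
    (S : (int -> R) -> (int -> R)) :
    (forall f : int -> R, quaternary_equations m beta f (S f)) ->
  relaxed_quaternary_scheme m (rule_coef m beta) S.
Proof.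
move=> eqs; apply: quaternary_rules_linear => r g phi.
rewrite (quaternary_equations_terms _ _ _ _ _ (eqs g)).
rewrite (sum_by_offset _ (relaxed_points m r) (fun p => beta p.1 * beta p.2)
           (fun j => g (phi + j))) ?rule_terms_offset //; last first.
  by rewrite /relaxed_points; case: ifP => _; exact: zrange_uniq.
by apply: eq_bigr => j _; rewrite /rule_coef big_map big_filter.
Qed.

Theorem theorem2p3 (R : realType) (m : nat) (hm : (1 <= m)%N) :
  (forall beta f h : int -> R,
     h = binary_scheme m beta (binary_scheme m beta f) ->
     quaternary_equations m beta f h) /\
  exists c : (int -> R) -> 'I_4 -> int -> R,
    (forall (beta : int -> R) (S : (int -> R) -> (int -> R)),
       (forall f : int -> R, quaternary_equations m beta f (S f)) ->
       relaxed_quaternary_scheme m (c beta) S) /\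
    (forall (r : 'I_4) (j : int), j \in relaxed_points m r ->
       sum_of_mask_products m (fun beta => c beta r j)).
Proof.
split=> [beta f h ->|]; first exact: binary_scheme_twice.
exists (rule_coef m); split=> [beta S eqs|r j jr].
  exact: quaternary_equations_scheme.
exact: rule_coef_mask_products.
Qed.
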